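(* Let $A\in\mathbb{R}^{m\times n}$, $\sigma>0$, $\epsilon\in(0,1)$, an uncertainty set $\mathcal{U}\subset\mathbb{R}^m$ and a positive integer $s\le n$ be given. Let $H=[h_1,\dots,h_n]\in\mathbb{R}^{m\times n}$ satisfy the condition $\mathbf{H}_{s,\infty}(\kappa)$ for some $\kappa<1/2$, and let reals $\rho_i>0$ satisfy $\rho_i\ge\nu_i:=\nu(h_i)$, $i=1,\dots,n$. Let $\widehat{x}_{\rm reg}(\cdot)$ be the regular $\ell_1$-recovery associated with $H$ and $\rho_1,\dots,\rho_n$, and let $\widehat\rho=\max_i\rho_i$, $\nu(H)=\max_i\nu(h_i)$. Then there exists a set $\Xi\subset\mathbb{R}^m$ with $\mathrm{Prob}\{\xi\in\Xi\}\ge 1-\epsilon$ (where $\xi\sim N(0,I_m)$) such that whenever $\xi\in\Xi$, for every $x\in\mathbb{R}^n$ and every $u\in\mathcal{U}$ one has $$\|\widehat{x}_{\rm reg}(Ax+\sigma\xi+u)-x\|_1\le \frac{2\|x-x^s\|_1}{1-2\kappa}+2s\,\frac{\widehat\rho+\nu(H)}{1-2\kappa},$$ $$\|\widehat{x}_{\rm reg}(Ax+\sigma\xi+u)-x\|_\infty\le s^{-1}\frac{\|x-x^s\|_1}{1-2\kappa}+\frac{\widehat\rho+\nu(H)}{1-2\kappa}.$$ In particular, for all $1\le p\le\infty$ and $\upsilon\ge0$, $$\mathrm{Risk}_p(\widehat{x}_{\rm reg}(\cdot)\,|\,\epsilon,\sigma,s,\upsilon)\le\frac{(2s)^{1/p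}}{1-2\kappa}\left(s^{-1}\upsilon+\widehat\rho+\nu(H)\right).$$
   Context: Observation model: $y=Ax+u+\sigma\xi\in\mathbb{R}^m$, where $A\in\mathbb{R}^{m\times n}$ is known, $x\in\mathbb{R}^n$ is an unknown signal, $\xi\sim N(0,I_m)$, $\sigma>0$ is known, and $u$ is an unknown nuisance belonging to a known (nonempty) convex compact set $\mathcal{U}\subset\mathbb{R}^m$ symmetric with respect to the origin. For $x\in\mathbb{R}^n$ and $1\le s\le n$, $x^s$ is the vector obtained from $x$ by setting to $0$ all but the $s$ largest in magnitude entries (ties are resolved in favour of smaller indices). $\nu(v)=\nu_{\epsilon,\sigma,\mathcal U}(v)=\sup_{u\in\mathcal{U}}u^Tv+\sigma\sqrt{2\ln(n/\epsilon)}\,\|v\|_2$, a norm on $\mathbb{R}^m$. Condition $\mathbf{H}_{s,\infty}(\kappa)$ ($s$ a positive integer, $\kappa>0$) on $H\in\mathbb{R}^{m\times n}$: $\|x\|_\infty\le\|H^TAx\|_\infty+s^{-1}\kappa\|x\|_1$ for all $x\in\mathbb{R}^n$. Regular $\ell_1$-recovery: $\widehat{x}_{\rm reg}(y)\in\mathrm{Argmin}_{v\in\mathbb{R}^n}\{\|v\|_1:\ |h_i^T(Av-y)|\le\rho_i,\ i=1,\dots,n\}$, a Borel function of $y$ (its value is arbitrary for those $y$ for which the problem is infeasible). $X(s,\upsilon)=\{x\in\mathbb{R}^n:\|x-x^s\|_1\le\upsilon\}$, and for a Borel $\widehat{x}:\mathbb{R}^m\to\mathbb{R}^n$, $$\mathrm{Risk}_p(\widehat{x}(\cdot)|\epsilon,\sigma,s,\upsilon)=\inf\{\delta:\mathrm{Prob}\{\xi:\exists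 x\in X(s,\upsilon),u\in\mathcal{U}:\|\widehat{x}(Ax+\sigma\xi+u)-x\|_p>\delta\}\le\epsilon\}.$$ Equivalently, $\mathrm{Risk}_p\le\delta$ iff there is a set $\Xi$ with $\mathrm{Prob}\{\xi\in\Xi\}\ge1-\epsilon$ such that $\|\widehat{x}(Ax+\sigma\xi+u)-x\|_p\le\delta$ for all $\xi\in\Xi$, $x\in X(s,\upsilon)$, $u\in\mathcal{U}$. *)

(* Defs.v *)
From HB Require Import structures.
From mathcomp Require Import all_boot all_order all_algebra.
From mathcomp Require Import all_classical all_reals all_analysis.

Set Implicit Arguments.
Unset Strict Implicit.
Unset Printing Implicit Defensive.

Import Order.TTheory GRing.Theory Num.Theory.
Import numFieldNormedType.Exports.

Local Open Scope classical_set_scope.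
Local Open Scope ring_scope.

(* R^m with its Borel sigma-algebra, generated by the open sets; as a type it
   is convertible to 'cV[R]_m. *)
Definition borelV (R : realType) (m : nat) := g_sigma_algebraType (@open 'cV[R]_m).

Lemma measurable_fun_borelV (R : realType) (d : measure_display)
    (T : measurableType d) (m : nat) (f : T -> borelV R m) :
  (forall i, measurable_fun [set: T] (fun t => (f t : 'cV[R]_m) i 0)) ->
  measurable_fun [set: T] f.
Proof.
move=> mf; apply: (@measurability _ _ T (borelV R m) setT f (@open 'cV[R]_m)) => //.
move=> _ [U oU <-]; rewrite setTI.
pose box (p : 'cV[rat]_m * rat) : set 'cV[R]_m :=
  [set v | forall i, ball (ratr (p.1 i 0) : R) (ratr p.2) (v i 0)].
have -> : f @^-1` U = \bigcup_(p in [set p | box p `<=` U]) (f @^-1` (box p)).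
  apply/seteqP; split => [t /= Ut|t [p /= pU pt]]; last by apply: pU; exact: pt.
  have /nbhs_ballP[e /= e0 eU] : nbhs (f t : 'cV[R]_m) U by exact: open_nbhs_nbhs.
  have [q /andP[q0 qe]] : exists q : rat, 0 < (ratr q : R) < e / 2.
    have [q] := rat_in_itvoo (divr_gt0 e0 (ltr0n R 2)).
    by rewrite in_itv/= => qe; exists q.
  have cP i : exists c : rat, ball ((f t : 'cV[R]_m) i 0) (ratr q) (ratr c : R).
    have [|c] := @rat_in_itvoo R ((f t : 'cV[R]_m) i 0) ((f t : 'cV[R]_m) i 0 + ratr q).
      by rewrite ltrDl.
    rewrite in_itv/= => /andP[c1 c2]; exists c.
    by rewrite /ball/= distrC ger0_norm ?subr_ge0 1?ltW// ltrBlDl.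
  pose c : 'cV[rat]_m := \col_i projT1 (cid (cP i)).
  have cB i : ball (ratr (c i 0) : R) (ratr q) ((f t : 'cV[R]_m) i 0).
    by rewrite mxE; apply: ball_sym; exact: (projT2 (cid (cP i))).
  exists (c, q) => //= v bv; apply: eU; split => // i j; rewrite (ord1 j).
  rewrite (splitr e); apply: (@ball_triangle _ _ (ratr (c i 0) : R)).
    by apply: ball_sym; apply: le_ball (cB i); exact: ltW.
  by apply: le_ball (bv i); exact: ltW.
rewrite bigcup_mkcond; apply: countable_bigcupT_measurable => // p.
case: ifP => // _.
have -> : f @^-1` box p = \bigcap_(i in [set: 'I_m])
    ((fun t => (f t : 'cV[R]_m) i 0) @^-1` ball (ratr (p.1 i 0) : R) (ratr p.2)).
  by apply/seteqP; split=> [t bt i _|t bt i]; [exact: bt|exact: (bt i)].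
apply: fin_bigcap_measurable => // i _; rewrite -[_ @^-1` _]setTI.
by apply: mf => //; exact: measurable_realfun.measurable_ball.
Qed.

Lemma measurable_coord (R : realType) (m : nat) (i : 'I_m) :
  measurable_fun [set: borelV R m] (fun v : borelV R m => (v : 'cV[R]_m) i 0).
Proof.
apply: (measurability _ (measurable_realfun.RGenOpens.measurableE R)) => //.
move=> _ [_ [a [b ->]] <-]; rewrite setTI.
apply: sub_sigma_algebra => /=.
have /continuousP := @coord_continuous R m 1 i 0; apply.
exact: interval_open.
Qed.

Definition vcons (R : realType) (m : nat) (xv : measurableTypeR R * borelV R m) :
    borelV R m.+1 :=
  col_mx (xv.1%:M : 'cV[R]_1) (xv.2 : 'cV[R]_m).

Lemma measurable_vcons (R : realType) (m : nat) :
  measurable_fun [set: measurableTypeR R * borelV R m] (@vcons R m).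
Proof.
apply: measurable_fun_borelV => i.
case: (@split_ordP 1 m i) => j ->.
  rewrite (_ : (fun _ => _) = fst) ?(ord1 j); first exact: measurable_fst.
  by apply/funext => xv; rewrite /vcons (@col_mxEu _ 1 m) mxE mulr1n.
rewrite (_ : (fun _ => _) = (fun v : borelV R m => (v : 'cV[R]_m) j 0) \o snd).
  by apply: measurableT_comp; [exact: measurable_coord|exact: measurable_snd].
by apply/funext => xv; rewrite /vcons (@col_mxEd _ 1 m).
Qed.

HB.instance Definition _ (R : realType) (m : nat) :=
  isMeasurableFun.Build _ _ _ _ (@vcons R m) (@measurable_vcons R m).

(* The law N(0, I_m): the m-fold product of the standard normal law. *)
Fixpoint std_gauss (R : realType) (m : nat) : probability (borelV R m) R :=
  match m with
  | 0 => dirac ((0 : 'cV[R]_0) : borelV R 0)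
  | m'.+1 => distribution (normal_prob 0 1 \x std_gauss R m')%E
              (@vcons R m' : {mfun (measurableTypeR R * borelV R m')%type >-> borelV R m'.+1})
  end.

Lemma measurable_box (R : realType) (m : nat) (B : 'I_m -> set R) :
  (forall i, measurable (B i)) ->
  measurable ([set v : 'cV[R]_m | forall i, B i (v i 0)] : set (borelV R m)).
Proof.
move=> mB.
have -> : [set v : 'cV[R]_m | forall i, B i (v i 0)] =
    \bigcap_(i in [set: 'I_m]) ((fun v : borelV R m => (v : 'cV[R]_m) i 0) @^-1` B i).
  by apply/seteqP; split=> [t bt i _|t bt i]; [exact: bt|exact: (bt i)].
apply: fin_bigcap_measurable => // i _; rewrite -[_ @^-1` _]setTI.
by apply: measurable_coord.
Qed.

Lemma std_gauss_box (R : realType) (m : nat) (B : 'I_m -> set R) :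
  (forall i, measurable (B i)) ->
  std_gauss R m [set v : 'cV[R]_m | forall i, B i (v i 0)] =
  (\prod_(i < m) normal_prob 0 1 (B i))%E.
Proof.
elim: m B => [|m IH] B mB.
  by rewrite big_ord0 /= diracE mem_set// => -[].
rewrite big_ord_recl -IH//= /distribution /pushforward.
have mB' := @measurable_box R m (fun j => B (lift ord0 j)) (fun j => mB _).
rewrite -(product_measure1E (normal_prob 0 1) (std_gauss R m) (mB ord0) mB').
congr product_measure1; apply/seteqP; split => [[x v] /= Bv|[x v] /= [Bx Bv] i].
  split=> [|i].
    have := Bv ord0; rewrite /vcons /=.
    have -> : ord0 = lshift m (ord0 : 'I_1) :> 'I_(1 + m) by exact: val_inj.
    by rewrite (@col_mxEu _ 1 m) mxE mulr1n.
  have := Bv (lift ord0 i); rewrite /vcons /=.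
  have -> : lift ord0 i = rshift 1 i :> 'I_(1 + m) by exact: val_inj.
  by rewrite (@col_mxEd _ 1 m).
rewrite /vcons; case: (@split_ordP 1 m i) => j ->.
  rewrite (@col_mxEu _ 1 m) (ord1 j) mxE mulr1n.
  by have -> : lshift m (0 : 'I_1) = ord0 by exact: val_inj.
rewrite (@col_mxEd _ 1 m).
by have -> : rshift 1 j = lift ord0 j by exact: val_inj.
Qed.

Definition dotv (R : realType) (m : nat) (u v : 'cV[R]_m) : R := (u^T *m v) 0 0.

Definition l1norm (R : realType) (n : nat) (x : 'cV[R]_n) : R :=
  \sum_(i < n) `|x i 0|.

Definition l2norm (R : realType) (n : nat) (x : 'cV[R]_n) : R :=
  Num.sqrt (\sum_(i < n) x i 0 ^+ 2).

(* The l_oo norm is the library's norm on matrices. *)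
Lemma norm_colE (R : realType) (n : nat) (x : 'cV[R]_n) :
  `|x| = \big[Num.max/0]_(i < n) `|x i 0|.
Proof.
rewrite -[`|x|]/(mx_norm x) mx_normrE; apply/le_anti/andP; split.
  apply: bigmax_le => [|[i j] _ /=]; first exact: bigmax_ge_id.
  by rewrite (ord1 j); apply: (le_bigmax _ (fun i => `|x i 0|)).
apply: bigmax_le => [|i _]; first exact: bigmax_ge_id.
exact: (le_bigmax _ (fun ij : 'I_n * 'I_1 => `|x ij.1 ij.2|) (i, 0)).
Qed.

Definition lpnorm (R : realType) (n : nat) (p : \bar R) (x : 'cV[R]_n) : R :=
  match p with
  | r%:E => (\sum_(i < n) `|x i 0| `^ r) `^ r^-1
  | +oo%E => `|x|
  | -oo%E => 0
  end.

Lemma lpnorm1 (R : realType) (n : nat) (x : 'cV[R]_n) : lpnorm 1%:E x = l1norm x.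
Proof.
rewrite /lpnorm invr1 powRr1; first by apply: eq_bigr => i _; rewrite powRr1.
by apply: sumr_ge0 => i _; exact: powR_ge0.
Qed.

Lemma lpnorm2 (R : realType) (n : nat) (x : 'cV[R]_n) : lpnorm 2%:E x = l2norm x.
Proof.
rewrite /lpnorm /l2norm powR12_sqrt; last first.
  by apply: sumr_ge0 => i _; exact: powR_ge0.
by congr Num.sqrt; apply: eq_bigr => i _; rewrite powR_mulrn// real_normK// num_real.
Qed.

(* The number of entries of x that come before the i-th one when entries are
   sorted by decreasing magnitude, smaller indices first among ties. *)
Definition magnitude_rank (R : realType) (n : nat) (x : 'cV[R]_n) (i : 'I_n) : nat :=
  #|[pred j : 'I_n | (`|x i 0| < `|x j 0|) ||
                    ((`|x i 0| == `|x j 0|) && (j < i)%N)]|.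

(* x^s *)
Definition largest_entries (R : realType) (n s : nat) (x : 'cV[R]_n) : 'cV[R]_n :=
  \col_i (if (magnitude_rank x i < s)%N then x i 0 else 0).

(* The integer n is the one in ln (n / eps); it is not the dimension of v. *)
Definition nu (R : realType) (m n : nat) (eps sigma : R) (U : set 'cV[R]_m)
    (v : 'cV[R]_m) : R :=
  sup [set dotv u v | u in U] + sigma * Num.sqrt (2 * ln (n%:R / eps)) * l2norm v.

(* Base 0 is harmless: nu is nonnegative for nonempty symmetric compact U. *)
Definition nuH (R : realType) (m n : nat) (eps sigma : R) (U : set 'cV[R]_m)
    (H : 'M[R]_(m, n)) : R :=
  \big[Num.max/0]_(i < n) nu n eps sigma U (col i H).

Definition condition_H (R : realType) (m n : nat) (A : 'M[R]_(m, n)) (s : nat)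
    (kappa : R) (H : 'M[R]_(m, n)) : Prop :=
  forall x : 'cV[R]_n,
    `|x| <= `|H^T *m A *m x| + s%:R^-1 * kappa * l1norm x.

Definition reg_feasible (R : realType) (m n : nat) (A H : 'M[R]_(m, n))
    (rho : 'I_n -> R) (y : 'cV[R]_m) : set 'cV[R]_n :=
  [set v | forall i, `|dotv (col i H) (A *m v - y)| <= rho i].

Definition regular_l1_recovery (R : realType) (m n : nat) (A H : 'M[R]_(m, n))
    (rho : 'I_n -> R) (xhat : 'cV[R]_m -> 'cV[R]_n) : Prop :=
  measurable_fun [set: borelV R m] (xhat : borelV R m -> borelV R n) /\
  forall y, reg_feasible A H rho y !=set0 ->
    reg_feasible A H rho y (xhat y) /\
    forall v, reg_feasible A H rho y v -> l1norm (xhat y) <= l1norm v.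

(* X(s, upsilon) *)
Definition nearly_sparse (R : realType) (n s : nat) (upsilon : R) : set 'cV[R]_n :=
  [set x | l1norm (x - largest_entries s x) <= upsilon].

(* The failure event, a projection of a Borel set, need not be Borel but is
   universally measurable; its probability is therefore its outer measure. *)
Definition risk (R : realType) (m n : nat) (A : 'M[R]_(m, n)) (U : set 'cV[R]_m)
    (p : \bar R) (xhat : 'cV[R]_m -> 'cV[R]_n) (eps sigma : R) (s : nat)
    (upsilon : R) : \bar R :=
  ereal_inf [set delta%:E | delta in [set delta : R |
    (mu_ext (std_gauss R m)
       [set xi : 'cV[R]_m | exists x u, [/\ nearly_sparse s upsilon x, U u
          & (delta < lpnorm p (xhat (A *m x + sigma *: xi + u) - x))%R]]
     <= eps%:E)%E]].

(* Main.v *)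
Require Import Defs.
From mathcomp Require Import all_boot all_order all_algebra.
From mathcomp Require Import all_classical all_reals all_analysis.
From mathcomp Require Import measurable_realfun.
From mathcomp Require Import ring lra.

Set Implicit Arguments.
Unset Strict Implicit.
Unset Printing Implicit Defensive.

Import Order.TTheory GRing.Theory Num.Theory.
Import numFieldNormedType.Exports.

Local Open Scope classical_set_scope.
Local Open Scope ring_scope.

(** Let c = sqrt (2 ln (n / eps)).  Outside an event of probability at most eps,
    every column h of H satisfies |h . xi| <= c ||h||_2; all the rest is
    deterministic.

    For the probability, the event |h . xi| > c ||h||_2 has probability at most
    exp (- c^2 / 2) = eps / n, and there are n columns.  Bounding each of the two
    half-spaces h . xi > c ||h||_2 and - h . xi > c ||h||_2 by exp (- c^2 / 2)
    would lose a factor 2.  Translating xi by a multiple of h instead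
    ([cameron_martin]) compares the half-space at distance c with the one at
    distance 0 ([std_gauss_halfspace_le]): its mass is at most exp (- c^2 / 2)
    times the mass of h . xi > 0.  The half-spaces h . xi > 0 and - h . xi > 0
    are disjoint, so their masses sum to at most 1 ([std_gauss_tail]).

    On the good event, |h_i . (sigma xi + u)| <= nu (h_i) <= rho_i by symmetry of
    U ([dotv_nuisance_noise]), so x is feasible in the problem that defines the
    recovery v, whence ||v||_1 <= ||x||_1.  The error z = v - x then has l1 norm
    at most 2 s ||z||_oo + 2 tau with tau = ||x - x^s||_1 ([l1norm_cone]), because
    its mass off the s largest entries of x is controlled by its mass on them;
    and the condition on H gives ||z||_oo <= c' + (kappa / s) ||z||_1, where
    c' = max rho + max nu bounds H^T A z.  As 2 kappa < 1 these two inequalities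
    solve to the l1 and sup-norm bounds ([condition_H_error]).  The other lp norms
    follow by interpolation ([lpnorm_interpolation]), with the same good event. *)

(** * Inner products *)

Lemma dotvC (R : realType) (m : nat) (u v : 'cV[R]_m) : dotv u v = dotv v u.
Proof. by rewrite /dotv -[in LHS](trmxK v) -trmx_mul mxE. Qed.

Lemma dotvDr (R : realType) (m : nat) (u v w : 'cV[R]_m) :
  dotv u (v + w) = dotv u v + dotv u w.
Proof. by rewrite /dotv mulmxDr mxE. Qed.

Lemma dotvZr (R : realType) (m : nat) (a : R) (u v : 'cV[R]_m) :
  dotv u (a *: v) = a * dotv u v.
Proof. by rewrite /dotv -scalemxAr mxE. Qed.

Lemma dotvNl (R : realType) (m : nat) (u v : 'cV[R]_m) : dotv (- u) v = - dotv u v.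
Proof. by rewrite /dotv linearN mulNmx mxE. Qed.

Lemma dotvE (R : realType) (m : nat) (u v : 'cV[R]_m) :
  dotv u v = \sum_i u i 0 * v i 0.
Proof. by rewrite /dotv mxE; apply: eq_bigr => i _; rewrite mxE. Qed.

Lemma dotvv (R : realType) (m : nat) (h : 'cV[R]_m) : dotv h h = l2norm h ^+ 2.
Proof.
rewrite dotvE /l2norm sqr_sqrtr; last by apply: sumr_ge0 => i _; exact: sqr_ge0.
by apply: eq_bigr => i _; rewrite expr2.
Qed.

(** * The Cameron-Martin formula *)

Section density.
Local Open Scope ereal_scope.

(** The Radon-Nikodym derivative changes variables in integrals, and it agrees
    almost everywhere with any other density g. *)
Lemma ge0_integral_density d (T : measurableType d) (R : realType)
    (P : {finite_measure set T -> \bar R})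
    (mu : {sigma_finite_measure set T -> \bar R}) (g : T -> \bar R) :
  P `<< mu -> (forall x, 0 <= g x) -> measurable_fun [set: T] g ->
  (forall B, measurable B -> P B = \int[mu]_(x in B) g x) ->
  forall f : T -> \bar R, (forall x, 0 <= f x) -> measurable_fun [set: T] f ->
  \int[P]_x f x = \int[mu]_x (f x * g x).
Proof.
move=> Pmu g0 mg Pg f f0 mf.
rewrite -(Radon_Nikodym_SigmaFinite.change_of_variables Pmu)//.
apply: ae_eq_integral => //.
- apply: emeasurable_funM => //.
  exact: measurable_int (Radon_Nikodym_SigmaFinite.f_integrable _).
- exact: emeasurable_funM.
- apply: ae_eqe_mul2l; apply: integral_ae_eq => //.
    exact: Radon_Nikodym_SigmaFinite.f_integrable.
  by move=> B _ mB; rewrite -Radon_Nikodym_SigmaFinite.f_integral// -Pg.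
Qed.

Lemma lebesgue_measure_translation (R : realType) (a : R) (B : set R) :
  measurable B ->
  pushforward lebesgue_measure (+%R^~ a : _ -> measurableTypeR R) B =
  lebesgue_measure B.
Proof.
have ma : measurable_fun setT (+%R^~ a : measurableTypeR R -> measurableTypeR R).
  exact: measurable_funD.
move=> mB; apply/esym/lebesgue_measure_unique => //= _ [[c e]] _ <-.
rewrite /pushforward (_ : _ @^-1` _ = `](c - a)%R, (e - a)%R]%classic); last first.
  by apply/seteqP; split=> x /=; rewrite !in_itv/= ltrBlDr lerBrDr.
by rewrite !lebesgue_measure_itv/= !lte_fin ltrD2r -!EFinB opprB addrA subrK.
Qed.

Lemma ge0_integral_translation (R : realType) (a : R) (f : R -> \bar R) :
  (forall x, 0 <= f x) -> measurable_fun [set: R] f ->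
  \int[lebesgue_measure]_x f x = \int[lebesgue_measure]_x f (x + a)%R.
Proof.
move=> f0 mf.
have ma : measurable_fun setT (+%R^~ a : measurableTypeR R -> measurableTypeR R).
  exact: measurable_funD.
rewrite -(@ge0_integral_pushforward _ _ _ _ _ _ ma lebesgue_measure setT f)//.
by apply: eq_measure_integral => //= B mB _; exact/esym/lebesgue_measure_translation.
Qed.

(** Translation invariance of the Lebesgue measure, together with
    (x + a)^2 / 2 = x^2 / 2 + a x + a^2 / 2 in the exponent of the density. *)
Lemma normal_prob_shift (R : realType) (a : R) (f : R -> \bar R) :
  (forall x, 0 <= f x) -> measurable_fun [set: R] f ->
  \int[normal_prob 0 1]_x f x =
  \int[normal_prob 0 1]_x (f (x + a)%R * (expR (- (a * x) - a ^+ 2 / 2)%R)%:E).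
Proof.
move=> f0 mf.
have mpdf : measurable_fun [set: R] (fun x => (normal_pdf 0 1 x)%:E : \bar R).
  by apply/measurable_EFinP; exact: measurable_normal_pdf.
have pdf0 x : 0 <= (normal_pdf 0 1 x)%:E :> \bar R.
  by rewrite lee_fin normal_pdf_ge0.
have density := ge0_integral_density (@normal_prob_dominates R 0 1) pdf0 mpdf
  (fun B _ => erefl _).
have ma : measurable_fun setT (fun x : R => x + a)%R by exact: measurable_funD.
have mfa : measurable_fun setT (fun x : R => f (x + a)%R).
  exact: measurableT_comp.
rewrite !density//; last 2 first.
- by move=> x; rewrite mule_ge0// lee_fin expR_ge0.
- apply: emeasurable_funM => //; apply/measurable_EFinP.
  by apply: measurableT_comp => //; apply: measurable_funB => //;
    apply: measurableT_comp => //; exact: measurable_funM.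
rewrite (ge0_integral_translation a); last 2 first.
- by move=> x; rewrite mule_ge0.
- exact: emeasurable_funM.
apply: eq_integral => x _; rewrite -muleA -EFinM; congr (_ * _%:E).
rewrite !normal_pdfE ?oner_neq0//= mulrCA -expRD.
by congr (_ * expR _)%R; field.
Qed.

End density.

(** [std_gauss] is built by prepending a coordinate with [vcons]; this lemma and
    [dotv_vcons] split translations and inner products accordingly, for an
    induction on the dimension. *)
Lemma vconsD (R : realType) (m : nat) (x : R) (v : 'cV[R]_m) (a : 'cV[R]_m.+1) :
  (vcons (x, v) : 'cV[R]_m.+1) + a =
  vcons (x + a 0 0, v + \col_i a (lift ord0 i) 0).
Proof.
apply/matrixP => i j; rewrite (ord1 j) mxE /vcons /=.
case: (@split_ordP 1 m i) => k ->.
  rewrite !(@col_mxEu _ 1 m) !(ord1 k) !mxE !mulr1n.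
  by congr (_ + a _ _); exact: val_inj.
rewrite !(@col_mxEd _ 1 m) !mxE; congr (_ + a _ _); exact: val_inj.
Qed.

Lemma dotv_vcons (R : realType) (m : nat) (x : R) (v : 'cV[R]_m) (a : 'cV[R]_m.+1) :
  dotv a (vcons (x, v)) = a 0 0 * x + dotv (\col_i a (lift ord0 i) 0) v.
Proof.
rewrite !dotvE big_ord_recl; congr (_ * _ + _).
  have -> : ord0 = lshift m (ord0 : 'I_1) :> 'I_(1 + m) by exact: val_inj.
  by rewrite /vcons (@col_mxEu _ 1 m) mxE mulr1n.
apply: eq_bigr => i _; rewrite mxE; congr (_ * _).
have -> : lift ord0 i = rshift 1 i :> 'I_(1 + m) by exact: val_inj.
by rewrite /vcons (@col_mxEd _ 1 m).
Qed.

Lemma measurable_dotv (R : realType) (m : nat) (h : 'cV[R]_m) :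
  measurable_fun [set: borelV R m] (fun v : borelV R m => dotv h v).
Proof.
under eq_fun do rewrite dotvE.
apply: measurable_sum => i; apply: measurable_funM => //.
exact: measurable_coord.
Qed.

Lemma measurable_addv (R : realType) (m : nat) (a : 'cV[R]_m) :
  measurable_fun [set: borelV R m]
    (fun v : borelV R m => ((v : 'cV[R]_m) + a) : borelV R m).
Proof.
apply: measurable_fun_borelV => i.
under eq_fun do rewrite mxE.
by apply: measurable_funD => //; exact: measurable_coord.
Qed.

(** The density, with respect to the standard Gaussian law, of that law
    translated by - a. *)
Definition cameron_martin_weight (R : realType) (m : nat) (a v : 'cV[R]_m) : R :=
  expR (- dotv a v - dotv a a / 2).

Lemma measurable_cameron_martin_weight (R : realType) (m : nat) (a : 'cV[R]_m) :
  measurable_fun [set: borelV R m]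
    (fun v : borelV R m => cameron_martin_weight a v).
Proof.
rewrite /cameron_martin_weight; apply: measurableT_comp => //.
apply: measurable_funB => //; apply: measurableT_comp => //; exact: measurable_dotv.
Qed.

Lemma integral_std_gaussS (R : realType) (m : nat) (f : borelV R m.+1 -> \bar R) :
  (forall v, 0 <= f v)%E -> measurable_fun [set: borelV R m.+1] f ->
  (\int[std_gauss R m.+1]_v f v =
   \int[normal_prob 0 1]_x \int[std_gauss R m]_v f (vcons (x, v)))%E.
Proof.
move=> f0 mf.
rewrite [LHS](@ge0_integral_pushforward _ _ _ _ _ _ (@measurable_vcons R m)
  (normal_prob 0 1 \x std_gauss R m)%E setT f)// preimage_setT.
rewrite (fubini_tonelli1 (f \o @vcons R m))//.
- exact: measurableT_comp mf (@measurable_vcons R m).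
- by move=> v; exact: f0.
Qed.

(** Induction on the dimension: by Tonelli the first coordinate is translated
    with [normal_prob_shift] and the others with the induction hypothesis, and
    the weights multiply. *)
Lemma cameron_martin (R : realType) (m : nat) (a : 'cV[R]_m)
    (f : borelV R m -> \bar R) :
  (forall v, 0 <= f v)%E -> measurable_fun [set: borelV R m] f ->
  (\int[std_gauss R m]_v f v =
   \int[std_gauss R m]_v
     (f ((v : 'cV[R]_m) + a)%R * (cameron_martin_weight a v)%:E))%E.
Proof.
elim: m a f => [|m IH] a f f0 mf.
  rewrite !integral_dirac//; last first.
    apply: emeasurable_funM; first exact: measurableT_comp (measurable_addv a).
    by apply/measurable_EFinP; exact: measurable_cameron_martin_weight.
  rewrite diracE mem_set// !mul1e /cameron_martin_weight !dotvE !big_ord0.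
  by rewrite mul0r subr0 oppr0 expR0 mule1; congr f; apply/matrixP => -[].
pose a' : 'cV[R]_m := \col_i a (lift ord0 i) 0.
have mfa : measurable_fun setT (fun v : borelV R m.+1 =>
    (f ((v : 'cV[R]_m.+1) + a)%R * (cameron_martin_weight a v)%:E)%E).
  apply: emeasurable_funM; first exact: measurableT_comp (measurable_addv a).
  by apply/measurable_EFinP; exact: measurable_cameron_martin_weight.
have w0 k (b v : 'cV[R]_k) : (0 <= (cameron_martin_weight b v)%:E)%E.
  by rewrite lee_fin expR_ge0.
have mfv : measurable_fun setT (f \o @vcons R m).
  exact: measurableT_comp mf (@measurable_vcons R m).
rewrite !integral_std_gaussS//; last by move=> v; rewrite mule_ge0.
rewrite (@normal_prob_shift _ (a 0 0)); last 2 first.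
- by move=> x; apply: integral_ge0.
- apply: (measurable_fun_fubini_tonelli_F (m2 := std_gauss R m) (f \o @vcons R m)) => //.
  by move=> v; exact: f0.
apply: eq_integral => x _.
have mfx : measurable_fun setT (fun v : borelV R m => f (vcons (x + a 0 0, v))).
  exact: measurableT_comp mfv (pair1_measurable (x + a 0 0)).
rewrite (IH a')//.
rewrite -ge0_integralZr//; last 2 first.
- apply: emeasurable_funM; first exact: measurableT_comp mfx (measurable_addv a').
  by apply/measurable_EFinP; exact: measurable_cameron_martin_weight.
- by move=> v _; rewrite mule_ge0.
apply: eq_integral => v _.
rewrite /= -muleA -EFinM vconsD; congr (_ * _%:E)%E.
rewrite /cameron_martin_weight -expRD dotv_vcons -/a'; congr expR.
have -> : dotv a a = a 0 0 ^+ 2 + dotv a' a'.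
  by rewrite !dotvE big_ord_recl expr2; congr (_ + _); apply: eq_bigr => i _; rewrite !mxE.
by field.
Qed.

(** * Gaussian tails of linear forms *)

Lemma measurable_halfspace (R : realType) (m : nat) (h : 'cV[R]_m) (c : R) :
  measurable ([set v | c < dotv h v] : set (borelV R m)).
Proof.
rewrite -[X in measurable X]setTI.
rewrite (_ : [set v | _] = (fun v : borelV R m => dotv h v) @^-1` `]c, +oo[).
  by apply: measurable_dotv => //; exact: measurable_itv.
by apply/seteqP; split=> v /=; rewrite in_itv/= andbT.
Qed.

(** Translating by t h turns the half-space on the left into h . v > 0, where
    the weight exp (- t (h . v) - t^2 ||h||^2 / 2) is at most
    exp (- t^2 ||h||^2 / 2).  Keeping the mass of h . v > 0 as a factor is what
    makes the two-sided bound below free of a factor 2. *)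
Lemma std_gauss_halfspace_le (R : realType) (m : nat) (h : 'cV[R]_m) (t : R) :
  0 <= t ->
  (std_gauss R m [set v : 'cV[R]_m | (t * dotv h h < dotv h v)%R] <=
   (expR (- (t ^+ 2 * dotv h h / 2)))%:E *
   std_gauss R m [set v : 'cV[R]_m | (0 < dotv h v)%R])%E.
Proof.
move=> t0; pose S c : set (borelV R m) := [set v | c < dotv h v].
have mS c : measurable (S c) by exact: measurable_halfspace.
rewrite -/(S _) -/(S 0).
have mI c : measurable_fun [set: borelV R m] (fun v => (\1_(S c) v)%:E : \bar R).
  by apply/measurable_EFinP; exact: measurable_indic.
rewrite -[X in std_gauss R m X]setIT -[X in (_ * std_gauss R m X)%E]setIT.
rewrite -!integral_indic// (@cameron_martin _ _ (t *: h))//.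
rewrite -ge0_integralZl//.
apply: ge0_le_integral => //.
- by move=> v _; rewrite -EFinM lee_fin mulr_ge0// expR_ge0.
- apply: emeasurable_funM.
    exact: (measurableT_comp (mI _) (measurable_addv _)).
  by apply/measurable_EFinP; exact: measurable_cameron_martin_weight.
- exact: emeasurable_funM.
move=> v _; rewrite -!EFinM lee_fin.
have -> : \1_(S (t * dotv h h)) ((v : 'cV[R]_m) + t *: h) = \1_(S 0) v :> R.
  rewrite !indicE; congr (_%:R); congr nat_of_bool.
  by apply/idP/idP; rewrite !inE /S/= dotvDr dotvZr ltrDr.
rewrite indicE; case: (boolP (v \in _)) => [|_]; last by rewrite mul0r mulr0.
rewrite inE /S/= mul1r mulr1 => hv.
rewrite /cameron_martin_weight ler_expR dotvZr ![dotv (t *: h) _]dotvC !dotvZr.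
rewrite (dotvC v h) expr2 -mulrA; have := mulr_ge0 t0 (ltW hv); lra.
Qed.

(** The half-spaces for h and - h both satisfy [std_gauss_halfspace_le], and the
    masses of h . v > 0 and - h . v > 0 sum to at most 1. *)
Lemma std_gauss_tail (R : realType) (m : nat) (h : 'cV[R]_m) (c : R) :
  0 <= c ->
  (std_gauss R m [set v : 'cV[R]_m | (c * l2norm h < `|dotv h v|)%R] <=
   (expR (- (c ^+ 2 / 2)))%:E)%E.
Proof.
move=> c0.
(* If h = 0 then dotv h vanishes and the strict inequality never holds. *)
have [h0|h0] := eqVneq (l2norm h) 0.
  rewrite (_ : [set v | _] = set0) ?measure0 ?lee_fin ?expR_ge0//.
  apply/seteqP; split=> // v /=; rewrite h0 mulr0 normr_gt0 => /negP; apply; apply/eqP.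
  have : dotv h h = 0 by rewrite dotvv h0 expr0n.
  rewrite !dotvE => /eqP; rewrite psumr_eq0 => [/allP hi|i _]; last first.
    by rewrite -expr2 sqr_ge0.
  rewrite big1// => i _; have := hi i (mem_index_enum _).
  by rewrite mulf_eq0 orbb => /eqP ->; rewrite mul0r.
have hp : 0 < l2norm h by rewrite lt_neqAle eq_sym h0 sqrtr_ge0.
(* This t puts the half-space t * dotv h h < dotv h v at distance c from 0. *)
pose t := c / l2norm h.
have t0 : 0 <= t by rewrite divr_ge0// ltW.
have thh g : dotv g g = dotv h h -> t * dotv g g = c * l2norm h.
  by move=> ->; rewrite dotvv expr2 mulrA /t divfK.
have tthh g : dotv g g = dotv h h -> t ^+ 2 * dotv g g = c ^+ 2.
  by move=> ->; rewrite dotvv -exprMn /t divfK.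
have side g : dotv g g = dotv h h ->
    (std_gauss R m [set v : 'cV[R]_m | (c * l2norm h < dotv g v)%R] <=
     (expR (- (c ^+ 2 / 2)))%:E *
     std_gauss R m [set v : 'cV[R]_m | (0 < dotv g v)%R])%E.
  by move=> gh; have := std_gauss_halfspace_le g t0; rewrite thh// tthh.
have NN : dotv (- h) (- h) = dotv h h.
  by rewrite dotvNl dotvC dotvNl opprK.
have mH := @measurable_halfspace R m.
have -> : [set v : 'cV[R]_m | c * l2norm h < `|dotv h v|] =
    [set v | c * l2norm h < dotv h v] `|` [set v | c * l2norm h < dotv (- h) v].
  apply/seteqP; split=> v /=; first by rewrite lter_normr => /orP[]; rewrite -?dotvNl; [left|right].
  by rewrite dotvNl => -[]; rewrite lter_normr => ->; rewrite ?orbT.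
apply: (le_trans (measureU2 _ (mH _ _) (mH _ _))).
apply: (le_trans (leeD (side h erefl) (side _ NN))).
rewrite -ge0_muleDr// -measureU//; last first.
  apply/seteqP; split=> // v /= []; rewrite dotvNl oppr_gt0 => /lt_trans/[apply].
  by rewrite ltxx.
rewrite -[leRHS]mule1; apply: lee_wpmul2l; first by rewrite lee_fin expR_ge0.
by apply: probability_le1; exact: measurableU.
Qed.

Lemma std_gauss_union_tail (R : realType) (m n : nat) (H : 'M[R]_(m, n)) (c : R) :
  0 <= c ->
  let bad : set (borelV R m) :=
    [set v | exists i, c * l2norm (col i H) < `|dotv (col i H) v|] in
  measurable bad /\
  (std_gauss R m bad <= (n%:R * expR (- (c ^+ 2 / 2)))%:E)%E.
Proof.
move=> c0 bad.
pose B i : set (borelV R m) :=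
  [set v | c * l2norm (col i H) < `|dotv (col i H) v|].
have mB i : measurable (B i).
  rewrite -[X in measurable X]setTI (_ : B i =
    (fun v : borelV R m => `|dotv (col i H) v|) @^-1` `]c * l2norm (col i H), +oo[).
    have mn : measurable_fun setT (fun v : borelV R m => `|dotv (col i H) v|).
      by apply: measurableT_comp => //; exact: measurable_dotv.
    by apply: mn => //; exact: measurable_itv.
  by apply/seteqP; split=> v /=; rewrite in_itv/= andbT.
have -> : bad = \big[setU/set0]_(i < n) B i.
  rewrite -bigcup_seq; apply/seteqP; split=> v [i]; last by exists i.
  by move=> Bv; exists i => //=; exact: mem_index_enum.
have -> : (n%:R * expR (- (c ^+ 2 / 2)))%:E =
    (\sum_(i < n) (expR (- (c ^+ 2 / 2)))%:E)%E :> \bar R.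
  by rewrite sumEFin sumr_const card_ord mulr_natl.
elim/big_rec2: _ => [|i y S _ [mS Sy]]; first by rewrite measure0.
split; first exact: measurableU.
apply: (le_trans (measureU2 _ (mB i) mS)).
by apply: leeD => //; exact: std_gauss_tail.
Qed.

(** * Deterministic error bounds *)

(** The order whose predecessors [magnitude_rank] counts. *)
Definition precedes (R : realType) (n : nat) (x : 'cV[R]_n) (j i : 'I_n) : bool :=
  (`|x i 0| < `|x j 0|) || ((`|x i 0| == `|x j 0|) && (j < i)%N).

Lemma magnitude_rank_lt (R : realType) (n : nat) (x : 'cV[R]_n) (i j : 'I_n) :
  precedes x j i -> (magnitude_rank x j < magnitude_rank x i)%N.
Proof.
move=> ji; apply: proper_card; apply/properP; split; last first.
  by exists j => //; rewrite !inE ltxx eqxx ltnn.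
apply/fintype.subsetP => k; rewrite !inE.
move: ji; rewrite /precedes.
move=> /orP[ij|/andP[/eqP -> ji]] /orP[jk|/andP[/eqP jk kj]].
- by rewrite (lt_trans ij jk).
- by rewrite -jk ij.
- by rewrite jk.
- by rewrite jk eqxx (ltn_trans kj ji) orbT.
Qed.

(** Breaking ties by index makes the order total, so ranks are distinct; hence
    at most s entries are retained in x^s. *)
Lemma magnitude_rank_inj (R : realType) (n : nat) (x : 'cV[R]_n) :
  injective (magnitude_rank x).
Proof.
move=> i j rij; apply/eqP/negPn/negP => ij.
have : precedes x j i || precedes x i j.
  rewrite /precedes; case: ltgtP => //= _.
  by move: ij; rewrite -val_eqE/=; case: ltngtP.
by case/orP => /magnitude_rank_lt; rewrite rij ltnn.
Qed.

Lemma card_largest_entries (R : realType) (n s : nat) (x : 'cV[R]_n) :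
  (#|[pred i | (magnitude_rank x i < s)%N]| <= s)%N.
Proof.
rewrite cardE -(size_map (magnitude_rank x)) -[leqRHS](size_iota 0).
apply: uniq_leq_size; first by rewrite map_inj_uniq ?enum_uniq//; exact: magnitude_rank_inj.
by move=> k /mapP[i]; rewrite mem_enum inE => ri ->; rewrite mem_iota.
Qed.

Lemma le_norm_col (R : realType) (n : nat) (x : 'cV[R]_n) (i : 'I_n) :
  `|x i 0| <= `|x|.
Proof. by rewrite norm_colE; exact: (le_bigmax _ (fun i => `|x i 0|)). Qed.

(** Entry by entry, |v_i - x_i| <= |v_i| - |x_i| + 2 |v_i - x_i| always and
    |v_i - x_i| <= |v_i| - |x_i| + 2 |x_i| always.  Use the former on the at most
    s retained entries of x and the latter elsewhere, and sum: the terms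
    |v_i| - |x_i| contribute at most 0. *)
Lemma l1norm_cone (R : realType) (n s : nat) (x v : 'cV[R]_n) :
  l1norm v <= l1norm x ->
  l1norm (v - x) <=
    2 * s%:R * `|v - x| + 2 * l1norm (x - largest_entries s x).
Proof.
move=> vx; set I := [pred i | (magnitude_rank x i < s)%N].
have : l1norm (v - x) <= (l1norm v - l1norm x) +
    (2 * (\sum_(i in I) `|(v - x) i 0|) + 2 * l1norm (x - largest_entries s x)).
  rewrite [X in 2 * X + _]big_mkcond /= !mulr_sumr -sumrB -!big_split /=.
  apply: ler_sum => i _; rewrite !mxE inE.
  case: ifP => _.
    rewrite subrr normr0 mulr0 addr0.
    have := ler_normB (v i 0) (v i 0 - x i 0).
    by rewrite subKr => ?; lra.
  by rewrite subr0 mulr0 add0r; have := ler_normB (v i 0) (x i 0); lra.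
have : \sum_(i in I) `|(v - x) i 0| <= s%:R * `|v - x|.
  apply: (@le_trans _ _ (\sum_(i in I) `|v - x|)).
    by apply: ler_sum => i _; exact: le_norm_col.
  rewrite sumr_const -[leLHS]mulr_natl ler_wpM2r// ler_nat.
  exact: card_largest_entries.
by move=> ? ?; rewrite -mulrA; lra.
Qed.

(** Insert the bound of [condition_H] on the sup norm into the l1 inequality,
    solve for the l1 norm, and insert the result back.  The coefficient
    2 kappa / (1 - 2 kappa) of tau / s obtained for the sup norm is relaxed to
    1 / (1 - 2 kappa). *)
Lemma condition_H_error (R : realType) (m n s : nat) (A H : 'M[R]_(m, n))
    (kappa c tau : R) (z : 'cV[R]_n) :
  (0 < s)%N -> 0 < kappa -> kappa < 1 / 2 -> 0 <= tau ->
  condition_H A s kappa H ->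
  l1norm z <= 2 * s%:R * `|z| + 2 * tau ->
  `|H^T *m A *m z| <= c ->
  l1norm z <= 2 * tau / (1 - 2 * kappa) + 2 * s%:R * (c / (1 - 2 * kappa)) /\
  `|z| <= s%:R^-1 * (tau / (1 - 2 * kappa)) + c / (1 - 2 * kappa).
Proof.
move=> s0 k0 k2 tau0 HC z1 zc.
have zoo := le_trans (HC z) (lerD zc (lexx _)).
have d0 : 0 < 1 - 2 * kappa by lra.
have {}s0 : 0 < s%:R :> R by rewrite ltr0n.
have l1z : l1norm z * (1 - 2 * kappa) <= 2 * tau + 2 * s%:R * c.
  have : s%:R * `|z| <= s%:R * c + kappa * l1norm z.
    have := ler_wpM2l (ltW s0) zoo.
    by rewrite mulrDr -!mulrA mulVKf ?gt_eqF.
  by rewrite -mulrA in z1 *; lra.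
have l1z' : l1norm z <= 2 * tau / (1 - 2 * kappa) + 2 * s%:R * (c / (1 - 2 * kappa)).
  by rewrite mulrA -mulrDl ler_pdivlMr.
split => //.
apply: (le_trans zoo); rewrite [leRHS]addrC.
have c0 : 0 <= c := le_trans (normr_ge0 _) zc.
have si0 : 0 <= s%:R^-1 :> R by rewrite invr_ge0 ltW.
apply: (le_trans (lerD (lexx c) (ler_wpM2l (mulr_ge0 si0 (ltW k0)) l1z'))).
set T := tau / (1 - 2 * kappa); set C := c / (1 - 2 * kappa).
have T0 : 0 <= s%:R^-1 * T by rewrite mulr_ge0// divr_ge0// ltW.
have -> : c = C * (1 - 2 * kappa) by rewrite /C divfK// gt_eqF.
rewrite -[2 * tau / _]mulrA -/T (_ : s%:R^-1 * kappa * (2 * T + 2 * s%:R * C) =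
  2 * kappa * (s%:R^-1 * T) + 2 * kappa * C); last by field; rewrite gt_eqF.
have : 2 * kappa * (s%:R^-1 * T) <= 1 * (s%:R^-1 * T) by rewrite ler_wpM2r//; lra.
lra.
Qed.

(** For finite p, the sum of the |z_i|^p is at most ||z||_oo^(p - 1) ||z||_1,
    hence at most c M^p.  For infinite p the exponent of c is 0. *)
Lemma lpnorm_interpolation (R : realType) (n : nat) (p : \bar R) (c M : R)
    (z : 'cV[R]_n) :
  (1 <= p)%E -> 0 <= c -> 0 <= M -> l1norm z <= c * M -> `|z| <= M ->
  lpnorm p z <= c `^ fine (p^-1)%E * M.
Proof.
case: p => [r| |]//; last by move=> _ c0 M0 _ zM; rewrite invey powRr0 mul1r.
rewrite lee_fin => r1 c0 M0 z1 zM /=.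
have r0 : 0 < r by lra.
rewrite inver gt_eqF//=.
have pow_split (a : R) : 0 <= a -> a `^ r = a * a `^ (r - 1).
  move=> a0; have [->|an0] := eqVneq a 0; first by rewrite mul0r powR0 ?gt_eqF.
  rewrite -[X in X * _](powRr1 a0) -powRD ?an0 ?implybT//.
  by congr (_ `^ _); lra.
have sum_le : \sum_i `|z i 0| `^ r <= c * M `^ r.
  apply: (@le_trans _ _ (\sum_i `|z i 0| * M `^ (r - 1))).
    apply: ler_sum => i _; rewrite pow_split// ler_wpM2l//.
    rewrite ge0_ler_powR ?nnegrE//; first lra.
    exact: le_trans (le_norm_col z i) zM.
  by rewrite -mulr_suml (pow_split M)// mulrA ler_wpM2r// powR_ge0.
apply: (@le_trans _ _ ((c * M `^ r) `^ r^-1)).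
  by rewrite ge0_ler_powR ?nnegrE ?invr_ge0 ?(ltW r0) ?mulr_ge0 ?powR_ge0 ?sumr_ge0.
by rewrite powRM ?powR_ge0// -powRrM divff ?gt_eqF// powRr1.
Qed.

Lemma compact_dotv_has_ubound (R : realType) (m : nat) (U : set 'cV[R]_m)
    (v : 'cV[R]_m) : compact U -> has_ubound [set dotv u v | u in U].
Proof.
move=> cU.
have [M [_ UM]] := compact_bounded cU.
exists ((M + 1) * l1norm v) => _ [u Uu <-].
rewrite /dotv mxE mulr_sumr; apply: ler_sum => i _; rewrite mxE.
apply: (le_trans (ler_norm _)); rewrite normrM ler_wpM2r//.
apply: le_trans (le_norm_col u i) _.
by apply: (UM (M + 1)) => //; rewrite ltrDl.
Qed.

(** The two terms of nu: the supremum over U bounds the nuisance, in absolute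
    value because U is symmetric, and the l2 term bounds the noise.  Compactness
    of U makes the real supremum an upper bound. *)
Lemma dotv_nuisance_noise (R : realType) (m n : nat) (eps sigma : R)
    (U : set 'cV[R]_m) (h xi u : 'cV[R]_m) :
  compact U -> (forall w, U w -> U (- w)) -> U u -> 0 <= sigma ->
  `|dotv h xi| <= Num.sqrt (2 * ln (n%:R / eps)) * l2norm h ->
  `|dotv h (sigma *: xi + u)| <= nu n eps sigma U h.
Proof.
move=> cU symU Uu sigma0 hxi.
have -> : dotv h (sigma *: xi + u) = dotv u h + sigma * dotv h xi.
  by rewrite [dotv u h]dotvC dotvDr dotvZr addrC.
rewrite (le_trans (ler_normD _ _))// lerD//.
  have ub := compact_dotv_has_ubound h cU.
  have le_sup w : U w -> dotv w h <= sup [set dotv u h | u in U].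
    by move=> Uw; apply: ub_le_sup => //; exists w.
  rewrite ler_norml lerNl -dotvNl !le_sup//; exact: symU.
by rewrite normrM ger0_norm// -mulrA ler_wpM2l.
Qed.

(** The residual of v, which is at most rho_i, differs from
    h_i . A (v - x) by h_i . eta; so the sup norm of H^T A (v - x) is at most c. *)
Lemma l1_recovery_error (R : realType) (m n s : nat) (A H : 'M[R]_(m, n))
    (kappa c : R) (rho nuv : 'I_n -> R) (x v : 'cV[R]_n) (eta : 'cV[R]_m) :
  (0 < s)%N -> 0 < kappa -> kappa < 1 / 2 -> condition_H A s kappa H ->
  (forall i, `|dotv (col i H) eta| <= nuv i) ->
  (forall i, rho i + nuv i <= c) -> 0 <= c ->
  reg_feasible A H rho (A *m x + eta) v -> l1norm v <= l1norm x ->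
  l1norm (v - x) <= 2 * l1norm (x - largest_entries s x) / (1 - 2 * kappa) +
    2 * s%:R * (c / (1 - 2 * kappa)) /\
  `|v - x| <= s%:R^-1 * (l1norm (x - largest_entries s x) / (1 - 2 * kappa)) +
    c / (1 - 2 * kappa).
Proof.
move=> s0 k0 k2 HC eta_nu c_ge c0 feas vx.
apply: (condition_H_error (A := A) (H := H)) => //.
- by apply: sumr_ge0.
- exact: l1norm_cone.
rewrite norm_colE; apply: bigmax_le => // i _.
have -> : (H^T *m A *m (v - x)) i 0 =
    dotv (col i H) (A *m v - (A *m x + eta)) + dotv (col i H) eta.
  rewrite -dotvDr.
  have -> : A *m v - (A *m x + eta) + eta = A *m (v - x).
    by rewrite mulmxBr opprD addrA subrK.
  by rewrite -mulmxA /dotv !mxE; apply: eq_bigr => k _; rewrite !mxE.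
exact: le_trans (ler_normD _ _) (le_trans (lerD (feas i) (eta_nu i)) (c_ge i)).
Qed.

(** * Recovery guarantee *)

Theorem proposition2 (R : realType) (m n : nat) (A : 'M[R]_(m, n))
    (sigma eps : R) (U : set 'cV[R]_m) (s : nat) (H : 'M[R]_(m, n))
    (kappa : R) (rho : 'I_n -> R) (xhat : 'cV[R]_m -> 'cV[R]_n)
    (sigma_gt0 : 0 < sigma) (eps01 : 0 < eps < 1)
    (U_neq0 : U !=set0) (U_convex : convex_set U) (U_compact : compact U)
    (U_sym : forall u, U u -> U (- u))
    (s_range : (1 <= s <= n)%N)
    (kappa_gt0 : 0 < kappa) (kappa_lt : kappa < 1 / 2)
    (H_cond : condition_H A s kappa H)
    (rho_gt0 : forall i, 0 < rho i)
    (rho_ge : forall i, nu n eps sigma U (col i H) <= rho i)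
    (xhat_reg : regular_l1_recovery A H rho xhat) :
  let rhohat := \big[Num.max/0]_(i < n) rho i in
  let nuHmax := nuH eps sigma U H in
  (exists Xi : set (borelV R m),
     [/\ measurable Xi,
         ((1 - eps)%:E <= std_gauss R m Xi)%E
       & forall xi : 'cV[R]_m, Xi xi -> forall (x : 'cV[R]_n) (u : 'cV[R]_m), U u ->
           l1norm (xhat (A *m x + sigma *: xi + u) - x) <=
             2 * l1norm (x - largest_entries s x) / (1 - 2 * kappa) +
             2 * s%:R * ((rhohat + nuHmax) / (1 - 2 * kappa)) /\
           `|xhat (A *m x + sigma *: xi + u) - x| <=
             s%:R^-1 * (l1norm (x - largest_entries s x) / (1 - 2 * kappa)) +
             (rhohat + nuHmax) / (1 - 2 * kappa)]) /\
  (forall (p : \bar R) (upsilon : R), (1 <= p)%E -> 0 <= upsilon ->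
     (risk A U p xhat eps sigma s upsilon <=
      ((2 * s%:R) `^ fine (p^-1)%E / (1 - 2 * kappa) *
       (s%:R^-1 * upsilon + rhohat + nuHmax))%:E)%E).
Proof.
move=> rhohat nuHmax.
have [eps0 eps1] : 0 < eps /\ eps < 1 by apply/andP.
have [s0 sn] : (0 < s)%N /\ (s <= n)%N by apply/andP.
have n0 : 0 < n%:R :> R by rewrite ltr0n (leq_trans s0).
have d0 : 0 < 1 - 2 * kappa by lra.
pose c : R := Num.sqrt (2 * ln (n%:R / eps)).
have c0 : 0 <= c by exact: sqrtr_ge0.
(* The square root in c is a genuine one, since n / eps >= 1. *)
have ln0 : 0 <= ln (n%:R / eps).
  rewrite ln_ge0// ler_pdivlMr// mul1r (le_trans (ltW eps1))// ler1n.
  exact: leq_trans s0 sn.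
have [] := std_gauss_union_tail H c0; set bad := [set v | _] => mbad.
have -> : n%:R * expR (- (c ^+ 2 / 2)) = eps.
  have -> : c ^+ 2 / 2 = ln (n%:R / eps) by rewrite sqr_sqrtr ?mulr_ge0//; field.
  by rewrite expRN lnK ?posrE ?divr_gt0// invf_div mulrCA divff ?mulr1 ?gt_eqF.
move=> bad_le.
have rn0 : 0 <= rhohat + nuHmax by rewrite addr_ge0 ?bigmax_ge_id.
have error xi x u : (~` bad) xi -> U u ->
    l1norm (xhat (A *m x + sigma *: xi + u) - x) <=
      2 * l1norm (x - largest_entries s x) / (1 - 2 * kappa) +
      2 * s%:R * ((rhohat + nuHmax) / (1 - 2 * kappa)) /\
    `|xhat (A *m x + sigma *: xi + u) - x| <=
      s%:R^-1 * (l1norm (x - largest_entries s x) / (1 - 2 * kappa)) +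
      (rhohat + nuHmax) / (1 - 2 * kappa).
  move=> good Uu; rewrite -addrA.
  have noise i : `|dotv (col i H) (sigma *: xi + u)| <= nu n eps sigma U (col i H).
    apply: dotv_nuisance_noise => //; first exact: ltW.
    by rewrite leNgt; apply/negP => ?; apply: good; exists i.
  have feas : reg_feasible A H rho (A *m x + (sigma *: xi + u)) x.
    move=> i; rewrite opprD addrA subrr add0r.
    rewrite dotvC dotvNl normrN dotvC.
    exact: le_trans (noise i) (rho_ge i).
  have [feas' min] := xhat_reg.2 _ (ex_intro _ _ feas).
  apply: (l1_recovery_error (A := A) (H := H) (rho := rho)
    (nuv := fun i => nu n eps sigma U (col i H))
    (eta := sigma *: xi + u)) => //.
  - by move=> i; apply: lerD; [exact: le_bigmax|
      exact: (le_bigmax _ (fun i => nu n eps sigma U (col i H)))].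
  - exact: min.
split.
  exists (~` bad); split; first exact: measurableC.
  - by rewrite probability_setC// EFinB leeB.
  - by move=> xi good x u Uu; exact: error.
move=> p upsilon p1 ups0; apply: ereal_inf_lbound.
set M := s%:R^-1 * upsilon + rhohat + nuHmax.
pose delta := (2 * s%:R) `^ fine (p^-1)%E * (M / (1 - 2 * kappa)).
exists delta; last by rewrite /delta mulrA mulrAC.
(* The failure event need not be measurable, but it is contained in bad. *)
apply: le_trans bad_le; rewrite -(measurable_mu_extE (std_gauss R m) mbad).
apply: le_mu_ext => xi /= [x [u [sparse Uu]]].
apply: contraPP => good; apply/negP; rewrite -leNgt.
have [e1 eoo] := error xi x u good Uu.
have sR : 0 < s%:R :> R by rewrite ltr0n.
have tau_le : l1norm (x - largest_entries s x) / (1 - 2 * kappa) <=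
    upsilon / (1 - 2 * kappa) by rewrite ler_wpM2r// invr_ge0 ltW.
have ME : M / (1 - 2 * kappa) = s%:R^-1 * (upsilon / (1 - 2 * kappa)) +
    (rhohat + nuHmax) / (1 - 2 * kappa) by rewrite /M -addrA mulrDl mulrA.
have error_oo : `|xhat (A *m x + sigma *: xi + u) - x| <= M / (1 - 2 * kappa).
  by apply: (le_trans eoo); rewrite ME lerD2r ler_wpM2l// invr_ge0 ltW.
apply: lpnorm_interpolation => //.
  exact: le_trans (normr_ge0 _) error_oo.
apply: (le_trans e1); rewrite ME mulrDr lerD2r.
by rewrite -!mulrA ler_wpM2l// mulVKf ?gt_eqF.
Qed.
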